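(* Let $V$ be a finite dimensional vector space over $\mathbb{Z}/2$ and let $g:V\to\mathbb{Z}/2$ be a non-degenerate quadratic form. Then the map $\psi:O(V,g)\to\mathbb{Z}/2$ defined by $$\psi(T)=\mathrm{rank}(T-Id)\bmod 2$$ is a (non-trivial) homomorphism.
   Context: A function $g:V\to\mathbb{Z}/2$ is a quadratic form if $g(x+y)=g(x)+g(y)+B(x,y)$ for all $x,y\in V$, where $B(x,y)$ is a bilinear form. $g$ is non-degenerate if $B$ is non-degenerate, i.e. for every $0\neq x\in V$ there is $y\in V$ with $B(x,y)\neq 0$ (then $\dim V$ is even). $O(V,g)$ is the group of all linear maps $T:V\to V$ with $g(T(x))=g(x)$ for all $x\in V$ (such $T$ are automatically invertible). $Id$ is the identity map of $V$. *)

(* Defs.v *)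
From HB Require Import structures.
From mathcomp Require Import all_boot all_order all_fingroup all_algebra.
From mathcomp Require Import all_solvable all_field.
From mathcomp Require Import sesquilinear.

Set Implicit Arguments.
Unset Strict Implicit.
Unset Printing Implicit Defensive.

Import GRing.Theory.
Local Open Scope ring_scope.

(* The bilinear form is determined by [qform], so carrying it as a field adds
   no data. *)
Record ndquad (V : vectType 'F_2) := NdQuad {
  qform :> V -> 'F_2;
  qbilin : {biscalar V};
  qformD : forall x y : V, qform (x + y) = qform x + qform y + qbilin x y;
  qbilin_nondeg : forall x : V, x != 0 -> exists y : V, qbilin x y != 0
}.

(* [finvect_type V] is [V] with its finite type structure, which makes the
   quantifier over all vectors boolean. *)
Definition preserves (V : vectType 'F_2) (g : ndquad V) : pred 'End(V) :=
  fun T => [forall x : finvect_type V, g (T x) == g x].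

Lemma preservesP (V : vectType 'F_2) (g : ndquad V) (T : 'End(V)) :
  reflect (forall x : V, g (T x) = g x) (preserves g T).
Proof.
apply: (iffP forallP) => [gT x | gT x]; last exact/eqP.
exact/eqP/(gT x).
Qed.

Record orthogonal_group (V : vectType 'F_2) (g : ndquad V) := Orthogonal {
  orth_val :> 'End(V);
  orth_valP : preserves g orth_val
}.

HB.instance Definition _ (V : vectType 'F_2) (g : ndquad V) :=
  [isSub for @orth_val V g].
HB.instance Definition _ (V : vectType 'F_2) (g : ndquad V) :=
  [Choice of orthogonal_group g by <:].

Section OrthogonalGroup.

Variables (V : vectType 'F_2) (g : ndquad V).
Implicit Types S T : orthogonal_group g.

Lemma orthE T x : g (T x) = g x.
Proof. exact: (elimT (preservesP g T) (orth_valP T)). Qed.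

Lemma orth_bilin T x y : qbilin g (T x) (T y) = qbilin g x y.
Proof.
by have := qformD g (T x) (T y); rewrite -linearD !orthE qformD => /addrI.
Qed.

Lemma orth_lker0 T : lker T == 0%VS.
Proof.
apply/lker0P/raddf_inj => x Tx0; apply/eqP.
apply: contraT => /(@qbilin_nondeg _ g)[y].
by rewrite -(orth_bilin T) Tx0 linear0l eqxx.
Qed.

Lemma preserves1 : preserves g \1%VF.
Proof. by apply/preservesP => x; rewrite id_lfunE. Qed.

Lemma preservesM S T : preserves g (S \o T)%VF.
Proof. by apply/preservesP => x; rewrite comp_lfunE !orthE. Qed.

Lemma preservesV T : preserves g (T^-1)%VF.
Proof.
apply/preservesP => x.
by rewrite -[in RHS](lker0_lfunVK (orth_lker0 T) x) orthE.
Qed.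

Definition orth_one : orthogonal_group g := Orthogonal preserves1.
Definition orth_mul S T := Orthogonal (preservesM S T).
Definition orth_inv T := Orthogonal (preservesV T).

Lemma orth_mulA : associative orth_mul.
Proof. by move=> S T U; apply: val_inj; rewrite /= comp_lfunA. Qed.

Lemma orth_mul1g : left_id orth_one orth_mul.
Proof. by move=> T; apply: val_inj; rewrite /= comp_lfun1l. Qed.

Lemma orth_mulg1 : right_id orth_one orth_mul.
Proof. by move=> T; apply: val_inj; rewrite /= comp_lfun1r. Qed.

Lemma orth_mulVg : left_inverse orth_one orth_inv orth_mul.
Proof. by move=> T; apply: val_inj; rewrite /= lker0_compVf ?orth_lker0. Qed.

Lemma orth_mulgV : right_inverse orth_one orth_inv orth_mul.
Proof. by move=> T; apply: val_inj; rewrite /= lker0_compfV ?orth_lker0. Qed.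

HB.instance Definition _ := isGroup.Build (orthogonal_group g)
  orth_mulA orth_mul1g orth_mulg1 orth_mulVg orth_mulgV.

Definition lfun_rank (f : 'End(V)) : nat := \dim (limg f).

Definition psi T : 'F_2 := (lfun_rank (orth_val T - \1%VF))%:R.

End OrthogonalGroup.

(* Main.v *)
Require Import Defs.
From mathcomp Require Import all_boot all_order all_fingroup all_algebra.
From mathcomp Require Import all_solvable all_field.
From HB Require Import structures.
From mathcomp Require Import sesquilinear.
From mathcomp Require Import zify.

Set Implicit Arguments.
Unset Strict Implicit.
Unset Printing Implicit Defensive.

Import GRing.Theory.

Local Open Scope ring_scope.

(** The map psi is the Dickson invariant.  The proof avoids generation of the
orthogonal group by transvections (which fails for the plus-type form in
dimension 4) and compares two isometries directly.

Write A = T - 1 and C = S - 1.  Since T preserves the polar form B of g, the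
kernel of A is the orthogonal complement of its image
([orthov_displacement]), and since T preserves g itself, B(Ay, y) = g(Ay)
([quad_displacement]).  Hence Wall's form w, w' |-> B(w, y'), with w' = Ay',
is well defined on im A and takes the value g(w) at the pair (w, w).  The
analogous form for C has the same diagonal, so on U = im A :&: im C the
difference of the two Wall forms is alternating, and its rank is even
([odd_dim_alternating]).  Its radical is A (ker (A - C)): a vector w is in the
radical when its preimages under A and C differ by an element of
perp U = ker A + ker C, that is, when w has a common preimage under A and C.
With dim (perp W) = dim V - dim W ([dim_orthov]), counting dimensions gives
  rank (A - C) + dim U + dim (A (ker (A - C))) = rank A + rank C,
so that rank (T - S) and rank (T - 1) + rank (S - 1) have the same parity
([odd_rank_sub]).  As rank (S^-1 T - 1) = rank (T - S), this is additivity of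
psi.

For non-triviality, g takes the value 1 somewhere as soon as V is non-zero,
for otherwise B would vanish; the transvection x |-> x + B(x, v) v along a
vector v with g(v) = 1 is an isometry whose displacement has rank 1. *)

(** * Orthogonal complements and alternating forms *)

Section HermitianForm.

Context {F : fieldType} {eps : bool} {theta : {rmorphism F -> F}}.
Context {V : vectType F} (form : {hermitian V for eps & theta}).
Implicit Types (u v w : V) (U W : {vspace V}) (D : 'End(V)).

Local Notation perp := (orthov form).

Lemma orthov_addv U W : perp (U + W) = (perp U :&: perp W)%VS.
Proof.
apply/eqP; rewrite eqEsubv subv_cap -orthovD subvv /= orthovD.
by rewrite capvSl capvSr.
Qed.

Lemma dim_orthov_span (X : seq V) :
  (\dim {:V} <= size X + \dim (perp <<X>>))%N.
Proof.
elim: X => [|x X IHX]; first by rewrite span_nil orthov0.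
rewrite span_cons orthov_addv capvC addSnnS (leq_trans IHX) // leq_add2l.
by have := leq_dim_orthov1 form x (perp <<X>>); case: (\dim _).
Qed.

(** The form u, v |-> form u (D v) restricted to U is alternating, hence
skew-symmetric, whatever the symmetry type of [form]. *)
Lemma orthov_alternating U D x y :
    {in U, forall u, form u (D u) = 0} -> x \in U -> y \in U ->
  form x (D y) = - form y (D x).
Proof.
move=> altD Ux Uy; apply/eqP; rewrite -addr_eq0.
have /eqP := altD (x + y) (memvD Ux Uy).
by rewrite (linearD D) linearDl !linearDr /= !altD // add0r addr0.
Qed.

(** An alternating form has even rank.  The form on U is encoded as
u, v |-> form u (D v), so that no form on the subspace alone has to be built,
and [U :&: D @^-1: perp U] is its radical.  A pair x, y on which the form does
not vanish spans a hyperbolic plane; its complement [U2] in U has codimension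
2 and the same radical, which allows induction on the dimension. *)
Lemma odd_dim_alternating U D :
    {in U, forall u, form u (D u) = 0} ->
  odd (\dim U) = odd (\dim (U :&: D @^-1: perp U)).
Proof.
have [n] := ubnP (\dim U); elim: n U => // n IHn U; rewrite ltnS => leUn altD.
have [/capv_idPl-> //|/subvPn[x Ux]] := boolP (U <= D @^-1: perp U)%VS.
rewrite -memv_preim => Dx_U; have := mem_orthovPn Dx_U => -[y Uy].
rewrite herm_eq0C => yDx.
have xDy : form x (D y) != 0 by rewrite (orthov_alternating altD) ?oppr_eq0.
pose U1 := (U :&: perp <[D x]>)%VS; pose U2 := (U1 :&: perp <[D y]>)%VS.
have inU1 u : (u \in U1) = (u \in U) && (form u (D x) == 0).
  by rewrite memv_cap mem_orthov1.
have inU2 u :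
    (u \in U2) = [&& u \in U, form u (D x) == 0 & form u (D y) == 0].
  by rewrite memv_cap inU1 mem_orthov1 -andbA.
have U1x : x \in U1 by rewrite inU1 Ux altD /=.
have Dy_U1 : D y \notin perp U1.
  by apply/mem_orthovPn; exists x => //; rewrite herm_eq0C.
have dimU1 : \dim U = (\dim U1).+1.
  rewrite -(eq_dim_orthov1 Dx_U) prednK // lt0n dimv_eq0.
  apply: contraNneq xDy => U0; rewrite U0 memv0 in Ux.
  by rewrite (eqP Ux) linear0l.
have dimU2 : \dim U1 = (\dim U2).+1.
  rewrite -(eq_dim_orthov1 Dy_U1) prednK // lt0n dimv_eq0.
  apply: contraNneq xDy => U0; rewrite U0 memv0 in U1x.
  by rewrite (eqP U1x) linear0l.
have sU2U : (U2 <= U)%VS by rewrite /U2 /U1 -capvA capvSl.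
rewrite dimU1 dimU2 /= negbK IHn; first 1 last.
- by rewrite (leq_trans _ leUn) // dimU1 dimU2.
- by move=> u /(subvP sU2U)/altD.
congr (odd (\dim _)); apply/vspaceP => u.
rewrite [LHS]memv_cap [RHS]memv_cap -!memv_preim.
apply/andP/andP => [[U2u U2Du] | [Uu UDu]]; last first.
  have u_perp v : v \in U -> form u (D v) == 0.
    move=> Uv; rewrite (orthov_alternating altD) // oppr_eq0 herm_eq0C.
    exact/eqP/(mem_orthovP UDu).
  split; first by rewrite inU2 Uu !u_perp.
  by apply/mem_orthovP => v /(subvP sU2U); apply/mem_orthovP.
(* Conversely, v in U is corrected by multiples of x and y, to which u is
   orthogonal, to land in U2. *)
have Uu := subvP sU2U u U2u; split=> //; apply/mem_orthovP => v Uv.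
move: U2u; rewrite inU2 => /and3P[_ /eqP uDx /eqP uDy].
have Dux : form x (D u) = 0.
  by rewrite (orthov_alternating altD) // uDx oppr0.
have Duy : form y (D u) = 0.
  by rewrite (orthov_alternating altD) // uDy oppr0.
pose a := form v (D y) / form x (D y); pose b := form v (D x) / form y (D x).
have U2v : v - a *: x - b *: y \in U2.
  rewrite inU2 !memvB ?memvZ //= !linearBl !linearZl_LR /= !altD // !mulr0.
  by rewrite !subr0 !divfK ?subrr ?eqxx.
have /eqP := mem_orthovP U2Du _ U2v; rewrite herm_eq0C.
rewrite !linearBl !linearZl_LR /= Dux Duy !mulr0 !subr0 herm_eq0C.
by move/eqP.
Qed.

Section Nondegenerate.

Hypothesis nondeg : forall u, u != 0 -> exists v, form u v != 0.

Lemma orthovf0 : orthov form fullv = 0%VS.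
Proof.
apply/eqP; rewrite -subv0; apply/subvP => u /mem_orthovP u_perp.
rewrite memv0; apply: contraT => /nondeg[v].
by rewrite u_perp ?memvf // eqxx.
Qed.

(** The lower bound for [perp U] counts equations.  The upper bound follows
from the lower bound for [perp U^C], because the two meet trivially. *)
Lemma dim_orthov U : (\dim U + \dim (perp U))%N = \dim {:V}.
Proof.
have leW W : (\dim {:V} <= \dim W + \dim (perp W))%N.
  have := dim_orthov_span (vbasis W).
  by rewrite size_tuple (span_basis (vbasisP W)).
have disj : (perp U :&: perp U^C = 0)%VS.
  by rewrite -orthov_addv addv_complf orthovf0.
have := dimvS (subvf (perp U + perp U^C)); rewrite dimv_disjoint_sum //.
have := leW U; have := leW U^C%VS; rewrite dimv_compl.
have := dimvS (subvf U).
lia.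
Qed.

Lemma orthov_capv U W : perp (U :&: W) = (perp U + perp W)%VS.
Proof.
apply/esym/eqP; rewrite eqEdim; apply/andP; split.
  apply/subvP => _ /memv_addP[u u_perp [w w_perp ->]].
  apply/mem_orthovP => v; rewrite memv_cap => /andP[Uv Wv].
  by rewrite linearDl /= (mem_orthovP u_perp) // (mem_orthovP w_perp) // addr0.
have /esym := dimv_sum_cap (perp U) (perp W); rewrite -orthov_addv.
have := dimv_sum_cap U W; have := dim_orthov (U + W)%VS.
have := dim_orthov U; have := dim_orthov W; have := dim_orthov (U :&: W)%VS.
lia.
Qed.

End Nondegenerate.

End HermitianForm.

(** * Arithmetic in the field with two elements *)

Lemma oppr_F2 (a : 'F_2) : - a = a.
Proof. exact: oppr_pchar2 (pchar_Fp (isT : prime 2)) a. Qed.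

Lemma addrr_F2 (a : 'F_2) : a + a = 0.
Proof. exact: addrr_pchar2 (pchar_Fp (isT : prime 2)) a. Qed.

Lemma F2_cases (a : 'F_2) : {a = 0} + {a = 1}.
Proof. by case: a => -[|[|//]] ?; [left | right]; apply: val_inj. Qed.

Lemma natr_F2 n : n%:R = (odd n)%:R :> 'F_2.
Proof.
by rewrite -[in LHS](odd_double_half n) natrD -addnn natrD addrr_F2 addr0.
Qed.

Lemma natr_addb_F2 (b c : bool) : (b (+) c)%:R = b%:R + c%:R :> 'F_2.
Proof. by case: b; case: c; rewrite ?addrr_F2 ?addr0 ?add0r. Qed.

(** * Parity of the rank of a difference of isometries *)

Section OrthogonalRank.

Context {V : vectType 'F_2} (g : ndquad V).
Implicit Types (S T : orthogonal_group g) (x y v w : V).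

Lemma quad0 : g 0 = 0.
Proof.
by have := qformD g 0 0; rewrite linear0l !addr0 addrr_F2.
Qed.

(** A copy of the bilinear form of g on which the symmetric-form structure can
be declared, so that orthogonal complements make sense. *)
Definition polar_form : V -> V -> 'F_2 := qbilin g.

(** Symmetry comes from expanding g (x + y) in both orders. *)
Lemma polar_formC x y : polar_form x y = polar_form y x.
Proof.
have := qformD g x y; rewrite addrC qformD [g y + _]addrC.
by move/addrI.
Qed.

Lemma polar_form_bilinear : bilinear_for *%R (idfun \; *%R) polar_form.
Proof. by split=> u a x y; rewrite /polar_form ?linearPr ?linearPl. Qed.

Lemma polar_form_hermitian x y :
  polar_form x y = (-1) ^+ false * idfun (polar_form y x).
Proof. by rewrite expr0 mul1r polar_formC. Qed.

HB.instance Definition _ := bilinear_isBilinear.Build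
  'F_2 V V 'F_2 *%R (idfun \; *%R) polar_form polar_form_bilinear.
HB.instance Definition _ := isHermitianSesquilinear.Build
  'F_2 V false idfun polar_form polar_form_hermitian.

Local Notation perp := (orthov polar_form).
Local Notation displacement T := (orth_val T - \1%VF).

(** The diagonal of the Wall form of T is the restriction of g: expand
g (T y) = g (y + (T - 1) y) = g y. *)
Lemma quad_displacement T y :
  polar_form (displacement T y) y = g (displacement T y).
Proof.
have := orthE T y; rewrite -[T y](subrK y) qformD -/polar_form.
rewrite [g _ + g y]addrC -addrA => /(canRL (addKr _)); rewrite addNr.
move/eqP; rewrite addrC addr_eq0 oppr_F2 => /eqP.
by rewrite lfunE /= lfunE /= id_lfunE.
Qed.

Lemma displacementE T x : displacement T x = T x - x.
Proof. by rewrite !lfunE /= opp_lfunE id_lfunE. Qed.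

(** If B(x, Ty - y) = 0 for all y, then x and T x have the same product with
every T y, and these exhaust V. *)
Lemma orthov_displacement T :
  perp (limg (displacement T)) = lker (displacement T).
Proof.
apply/vspaceP => x; rewrite memv_ker displacementE subr_eq0.
apply/mem_orthovP/eqP => [x_perp | Tx_x _ /memv_imgP[y _ ->]]; last first.
  rewrite displacementE linearBr /= -[in X in X - _]Tx_x.
  by rewrite [X in X - _]orth_bilin subrr.
apply/eqP; rewrite -subr_eq0; apply: contraT => /(@qbilin_nondeg _ g)[z].
rewrite -[z](lker0_lfunVK (orth_lker0 T)); set y := (_ z).
have /eqP := x_perp _ (memv_img (displacement T) (memvf y)).
rewrite displacementE linearBr /= subr_eq0 => /eqP xTy.
rewrite linearBl /= orth_bilin -[X in _ - X]/(polar_form x (T y)).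
by rewrite xTy subrr eqxx.
Qed.

(** The heart of the argument: rank (T - S) differs from the sum of the two
other ranks by dim U + dim (A (ker (A - C))), which is even because the
difference of the Wall forms on U is alternating with radical
A (ker (A - C)). *)
Lemma odd_rank_sub S T :
  odd (lfun_rank (orth_val T - orth_val S))
  = odd (lfun_rank (displacement S)) (+) odd (lfun_rank (displacement T)).
Proof.
(* The inverses choose preimages in the images, so D represents the
   difference of the Wall forms of T and S on U. *)
pose A : 'End(V) := displacement T; pose C : 'End(V) := displacement S.
pose U := (limg A :&: limg C)%VS.
pose D : 'End(V) := (A^-1)%VF - (C^-1)%VF; pose K := lker (A - C).
have DE w : D w = A^-1%VF w - C^-1%VF w by rewrite !lfunE /= opp_lfunE.
have nondeg : forall u, u != 0 -> exists v, polar_form u v != 0.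
  exact: qbilin_nondeg.
have altD : {in U, forall w, polar_form w (D w) = 0}.
  move=> w; rewrite memv_cap => /andP[Aw Cw]; rewrite DE linearBr /=.
  rewrite -{1}(limg_lfunVK Aw) quad_displacement -{2}(limg_lfunVK Cw).
  by rewrite quad_displacement !limg_lfunVK // subrr.
have perpU : perp U = (lker A + lker C)%VS.
  by rewrite orthov_capv // !orthov_displacement.
have radU : (U :&: D @^-1: perp U)%VS = (A @: K)%VS.
  apply/vspaceP => w; rewrite [LHS]memv_cap -memv_preim perpU.
  apply/idP/idP => [/andP[] | /memv_imgP[y]].
    rewrite memv_cap => /andP[Aw Cw] /memv_addP[a Aa [c Cc]].
    rewrite DE => /(canRL (subrK _)) Ew.
    move: Aa Cc; rewrite !memv_ker => /eqP Aa /eqP Cc.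
    (* The common preimage of w under A and C is A^-1 w - a = C^-1 w + c. *)
    have Ay : A (A^-1%VF w - a) = w by rewrite linearB /= Aa subr0 limg_lfunVK.
    apply/memv_imgP; exists (A^-1%VF w - a) => //.
    apply/eqlfunP; rewrite Ay.
    have -> : A^-1%VF w - a = c + C^-1%VF w.
      by rewrite Ew -(addrA a) [LHS]addrC addKr.
    by rewrite linearD /= Cc add0r limg_lfunVK.
  move/eqlfunP => AyCy ->; rewrite memv_cap memv_img ?memvf //=.
  rewrite {1}AyCy memv_img ?memvf //= DE {2}AyCy.
  have -> : A^-1%VF (A y) - C^-1%VF (C y) =
    (A^-1%VF (A y) - y) + (y - C^-1%VF (C y)) by rewrite addrA subrK.
  apply: memv_add; rewrite memv_ker linearB /= limg_lfunVK ?subrr //;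
    exact: memv_img (memvf _).
have kerAC : (K :&: lker A = lker A :&: lker C)%VS.
  apply/vspaceP => y; rewrite [LHS]memv_cap [RHS]memv_cap.
  apply/andP/andP => [[/eqlfunP Ey Ay] | [Ay Cy]].
    by split; first exact: Ay; rewrite memv_ker -Ey -memv_ker.
  split; last exact: Ay.
  by apply/eqlfunP; move: Ay Cy; rewrite !memv_ker => /eqP-> /eqP->.
have TS : orth_val T - orth_val S = A - C by rewrite /A /C opprB addrA subrK.
have dimK : (\dim (perp (limg A + limg C)) + \dim (A @: K) = \dim K)%N.
  by rewrite orthov_addv !orthov_displacement -kerAC limg_ker_dim.
have dim_perp : (\dim (limg A + limg C) + \dim (perp (limg A + limg C))
    = \dim {:V})%N := dim_orthov nondeg _.
have dim_sum : (\dim (limg A + limg C) + \dim U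
    = lfun_rank A + lfun_rank C)%N := dimv_sum_cap _ _.
have rankAC : (\dim K + lfun_rank (A - C)%R = \dim {:V})%N.
  by rewrite -(limg_ker_dim (A - C) fullv) capfv.
have oddU := odd_dim_alternating altD; rewrite radU in oddU.
have /(congr1 odd) : (lfun_rank (A - C)%R + (\dim U + \dim (A @: K))
    = lfun_rank C + lfun_rank A)%N by lia.
by rewrite !oddD oddU addbb addbF TS.
Qed.

Lemma psiE T : psi T = (odd (lfun_rank (displacement T)))%:R.
Proof. exact: natr_F2. Qed.

Lemma psi_mulVg S T : psi (S^-1 * T)%g = psi S + psi T.
Proof.
rewrite !psiE -natr_addb_F2 -odd_rank_sub; congr (odd _)%:R.
have -> : orth_val (S^-1 * T)%g - \1%VF
       = (orth_val S^-1%g \o (orth_val T - orth_val S))%VF.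
  by rewrite comp_lfunDr comp_lfunNr lker0_compVf ?orth_lker0.
rewrite /lfun_rank limg_comp limg_dim_eq //.
by rewrite (eqP (orth_lker0 S^-1%g)) capv0.
Qed.

Lemma psi1 : psi (1%g : orthogonal_group g) = 0.
Proof. by rewrite /psi /lfun_rank subrr lim0g dimv0. Qed.

Lemma psiM S T : psi (S * T)%g = psi S + psi T.
Proof.
by rewrite -[S in LHS]invgK psi_mulVg -[(S^-1)%g]mulg1 psi_mulVg psi1 addr0.
Qed.

(** If g vanished at x, y and x + y, then so would B(x, y). *)
Lemma exists_nonsingular : (0 < \dim {:V})%N -> exists v, g v = 1.
Proof.
rewrite lt0n dimv_eq0 => V_neq0.
have := memv_pick {:V}; have := vpick0 {:V}; rewrite (negPf V_neq0).
move/negbT/(@qbilin_nondeg _ g) => [y]; set x := vpick _ => Bxy _.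
case: (F2_cases (g x)) => [gx|]; last by exists x.
case: (F2_cases (g y)) => [gy|]; last by exists y.
exists (x + y); rewrite qformD gx gy !add0r.
by case: (F2_cases (qbilin g x y)) Bxy => ->.
Qed.

(** * Transvections *)

Definition transvection_fun v x := x + polar_form x v *: v.

Lemma transvection_fun_linear v : linear (transvection_fun v).
Proof.
move=> a x y; rewrite /transvection_fun linearDl linearZl_LR /=.
by rewrite scalerDl scalerDr scalerA addrACA.
Qed.

HB.instance Definition _ v := GRing.isLinear.Build
  'F_2 V V *:%R (transvection_fun v) (transvection_fun_linear v).

Lemma preserves_transvection v :
  g v = 1 -> preserves g (linfun (transvection_fun v)).
Proof.
move=> gv; apply/preservesP => x; rewrite lfunE /= /transvection_fun.
case: (F2_cases (polar_form x v)) => Bxv; rewrite Bxv.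
  by rewrite scale0r addr0.
rewrite scale1r qformD gv [qbilin g x v]Bxv.
by rewrite -addrA addrr_F2 addr0.
Qed.

Lemma psi_transvection v (gv : g v = 1) :
  psi (Orthogonal (preserves_transvection gv)) = 1.
Proof.
have v_neq0 : v != 0 by apply: contra_eq_neq gv => ->; rewrite quad0.
rewrite /psi /lfun_rank /=; set f := (_ - _).
have fE x : f x = polar_form x v *: v.
  by rewrite !lfunE /= opp_lfunE id_lfunE addrC lfunE /= addKr.
suff -> : limg f = <[v]>%VS by rewrite dim_vline v_neq0.
apply/eqP; rewrite eqEsubv; apply/andP; split.
  by apply/subvP => _ /memv_imgP[x _ ->]; rewrite fE memvZ ?memv_line.
have [y Bvy] : exists y, polar_form v y != 0 := qbilin_nondeg g v_neq0.
rewrite -memvE; apply/memv_imgP; exists y; rewrite ?memvf // fE polar_formC.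
by case: (F2_cases (polar_form v y)) Bvy => [->|->]; rewrite ?eqxx ?scale1r.
Qed.

End OrthogonalRank.

Unset Implicit Arguments.

(** * The Dickson invariant is a non-trivial homomorphism *)

Theorem theorem3p3 (V : vectType 'F_2) (g : ndquad V) :
  (forall S T : orthogonal_group g, psi (S * T)%g = psi S + psi T)
  /\ ((0 < \dim {:V})%N -> exists T : orthogonal_group g, psi T != 0).
Proof.
split; first exact: psiM.
case/(exists_nonsingular g) => v gv.
by exists (Orthogonal (preserves_transvection gv)); rewrite psi_transvection.
Qed.
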